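(* Let $R,r>0$ and let $\mathcal{K}^*_{\partial\Omega}$ be the Neumann–Poincaré operator on $K^{-1/2}_0$ for the touching disks $\Omega=B_R\cup B_{-r}$, as described in the context. Then $\mathcal{K}^*_{\partial\Omega}$ has only absolutely continuous spectrum, and its spectrum is $[-1/2,1/2]$.
   Context: Identify $\mathbb{R}^2$ with $\mathbb{C}$; for $a\in\mathbb{R}\setminus\{0\}$ let $B_a$ be the open disk of radius $|a|$ centered at $(a,0)$. Fix $R,r>0$, let $\Omega=B_R\cup B_{-r}$, and put $q_1=\frac1{2r}+\frac1{2R}>0$. For $k\neq0$ let $\mathbb{S}(k)=\frac{1}{2|k|}\mathrm{diag}(1-e^{-|k|q_1},\,1+e^{-|k|q_1})$ and $\mathbb{K}(k)=\frac12e^{-|k|q_1}\mathrm{diag}(1,-1)$. $K^{-1/2}_0$ is the Hilbert space of pairs $\hat\varphi=(\hat\varphi_1,\hat\varphi_2)^T$ of measurable complex functions on $\mathbb{R}$ (mod a.e.) with $\int_{\mathbb{R}}\hat\varphi^T\mathbb{S}\overline{\hat\varphi}\,dk<\infty$, inner product $\langle\psi,\varphi\rangle_{-1/2}=\int_{\mathbb{R}}\hat\psi^T\mathbb{S}\overline{\hat\varphi}\,dk$. (In the paper such a pair represents a boundary density on $\partial\Omega$ via $\varphi=U^{-1}P\hat\varphi$, $P=\frac1{\sqrt2}\begin{bmatrix}-1&1\\1&1\end{bmatrix}$, $U$ the Fourier transform of the density pulled back by $z\mapsto1/z$.) The Neumann–Poincaré operator $\mathcal{K}^*_{\partial\Omega}$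 on $K^{-1/2}_0$ is the multiplication operator $\hat\varphi\mapsto\mathbb{K}\hat\varphi$. *)

(* Defs.v *)
From HB Require Import structures.
From mathcomp Require Import all_boot all_order all_algebra.
From mathcomp Require Import all_classical all_reals all_analysis.
From mathcomp Require Import complex.
Set Implicit Arguments. Unset Strict Implicit. Unset Printing Implicit Defensive.
Import Order.TTheory GRing.Theory Num.Theory.
Import numFieldNormedType.Exports.
Local Open Scope classical_set_scope.
Local Open Scope ring_scope.
Local Open Scope complex_scope.

Section NP.
Variable R : realType.
Local Notation C := (R[i]).
Local Notation leb := (@lebesgue_measure R).

Definition q1 (Rad r : R) : R := (2 * r)^-1 + (2 * Rad)^-1.

(* Diagonal entries of S(k) and K(k) (values at k = 0 are irrelevant: null set) *)
Definition S1 (Rad r : R) (k : R) : R :=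
  (2 * `|k|)^-1 * (1 - expR (- (`|k| * q1 Rad r))).
Definition S2 (Rad r : R) (k : R) : R :=
  (2 * `|k|)^-1 * (1 + expR (- (`|k| * q1 Rad r))).
Definition K1 (Rad r : R) (k : R) : R := 2^-1 * expR (- (`|k| * q1 Rad r)).
Definition K2 (Rad r : R) (k : R) : R := - (2^-1 * expR (- (`|k| * q1 Rad r))).

Definition sqmod (z : C) : R := complex.Re z ^+ 2 + complex.Im z ^+ 2.

Definition cmeasurable (f : R -> C) : Prop :=
  measurable_fun setT (fun k => complex.Re (f k)) /\
  measurable_fun setT (fun k => complex.Im (f k)).

Definition wsq (Rad r : R) (phi : R -> C * C) (k : R) : R :=
  S1 Rad r k * sqmod (phi k).1 + S2 Rad r k * sqmod (phi k).2.

(* membership in K^{-1/2}_0 (elements are taken modulo a.e. equality) *)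
Definition inK (Rad r : R) (phi : R -> C * C) : Prop :=
  cmeasurable (fun k => (phi k).1) /\ cmeasurable (fun k => (phi k).2) /\
  (\int[leb]_k ((wsq Rad r phi k)%:E) < +oo)%E.

Definition normsq (Rad r : R) (phi : R -> C * C) : R :=
  Rintegral leb setT (wsq Rad r phi).

Definition ipf (Rad r : R) (psi phi : R -> C * C) (k : R) : C :=
  (S1 Rad r k)%:C * (psi k).1 * ((phi k).1)^* +
  (S2 Rad r k)%:C * (psi k).2 * ((phi k).2)^*.
Definition inner (Rad r : R) (psi phi : R -> C * C) : C :=
  Complex (Rintegral leb setT (fun k => complex.Re (ipf Rad r psi phi k)))
          (Rintegral leb setT (fun k => complex.Im (ipf Rad r psi phi k))).

Definition aeeq (phi psi : R -> C * C) : Prop :=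
  {ae leb, forall k, phi k = psi k}.

Definition NP (Rad r : R) (phi : R -> C * C) : R -> C * C :=
  fun k => ((K1 Rad r k)%:C * (phi k).1, (K2 Rad r k)%:C * (phi k).2).

Definition NPshift (Rad r : R) (z : C) (phi : R -> C * C) : R -> C * C :=
  fun k => ((NP Rad r phi k).1 - z * (phi k).1, (NP Rad r phi k).2 - z * (phi k).2).

Definition resolvent (Rad r : R) (z : C) : Prop :=
  (forall phi, inK Rad r phi -> aeeq (NPshift Rad r z phi) (fun _ => (0, 0)) ->
     aeeq phi (fun _ => (0, 0))) /\
  exists c : R, forall psi, inK Rad r psi ->
    exists phi, [/\ inK Rad r phi, aeeq (NPshift Rad r z phi) psi &
                    normsq Rad r phi <= c * normsq Rad r psi].

Definition spectrum (Rad r : R) : set C := [set z | ~ resolvent Rad r z].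

(* The spectral measure of phi w.r.t. the bounded self-adjoint operator NP:
   the (unique) finite Borel measure mu on the real line with
   int x^n dmu(x) = <NP^n phi, phi> for all n. *)
Definition spectral_measure_of (Rad r : R) (phi : R -> C * C)
    (mu : {measure set (measurableTypeR R) -> \bar R}) : Prop :=
  forall n : nat,
    mu.-integrable setT (fun x => (x ^+ n)%:E) /\
    (Rintegral mu setT (fun x => x ^+ n))%:C = inner Rad r (iter n (NP Rad r) phi) phi.

Definition only_ac_spectrum (Rad r : R) : Prop :=
  forall phi, inK Rad r phi ->
    (exists mu, spectral_measure_of Rad r phi mu) /\
    (forall mu, spectral_measure_of Rad r phi mu -> mu `<< leb).

End NP.

(* Main.v *)
Require Import Defs.
From HB Require Import structures.
From mathcomp Require Import all_boot all_order all_algebra.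
From mathcomp Require Import all_classical all_reals all_analysis.
From mathcomp Require Import complex.
From mathcomp Require Import measurable_realfun lra ring.
Set Implicit Arguments. Unset Strict Implicit. Unset Printing Implicit Defensive.
Import Order.TTheory GRing.Theory Num.Theory.
Import numFieldNormedType.Exports.
Local Open Scope classical_set_scope.
Local Open Scope ring_scope.

(* Absolute continuity: with w_i = S_i |phi_i|^2, the sum of the pushforwards of
   w_i dk by K_i has the moments <NP^n phi, phi>.  It is absolutely continuous
   because k |-> exp(-|k|q) is bi-Lipschitz on bounded intervals of either sign,
   so that preimages of null sets are null.  Its even moments grow at most like C/4^n,
   which confines any measure with these moments to a compact interval, where
   polynomials approximate indicators of rays; so the moments determine it.
   Spectrum: away from [-1/2,1/2] one divides by K_i - z; for real z in the
   segment, functions supported near a point k with K_i(k) close to z are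
   approximate eigenvectors. *)

(** * Measures given by a density *)

(** The integral formula is a change of variables: the Radon-Nikodym derivative of [nu] is almost
    everywhere [w]. A bounded [f] is integrable because [nu] has finite mass. *)
Lemma density_measure d (T : measurableType d) (R : realType)
    (m : {sigma_finite_measure set T -> \bar R}) (w : T -> R) :
  (forall x, 0 <= w x) -> m.-integrable setT (EFin \o w) ->
  exists nu : {finite_measure set T -> \bar R},
    (forall A, measurable A -> nu A = \int[m]_(x in A) (w x)%:E)%E /\
    forall (f : T -> R) (M : R), measurable_fun setT f ->
      (forall x, `|f x| <= M) ->
      nu.-integrable setT (EFin \o f) /\
      (\int[nu]_x (f x)%:E = \int[m]_x (f x * w x)%:E)%E.
Proof.
move=> w0 iw.
have we0 (x : T) : (0 <= (w x)%:E)%E by rewrite lee_fin.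
have mw : measurable_fun setT w by apply/measurable_EFinP; case/integrableP: iw.
pose f := fun A : set T => (\int[m]_(x in A) (w x)%:E)%E.
have f0 : f set0 = 0%E by rewrite /f integral_set0.
have fge A : (0 <= f A)%E by exact: integral_ge0.
have fs : semi_sigma_additive f.
  move=> A mA tA mUA; rewrite /f integral_bigcup//=; last first.
    exact: (integrableS _ _ (subsetT _) iw).
  by apply: is_cvg_ereal_nneg_natsum_cond => n _ _; exact: fge.
pose fm := isMeasure.Build _ _ _ f f0 fge fs.
pose fM : {measure set T -> \bar R} := HB.pack f fm.
have ffin : fin_num_fun fM.
  move=> A mA; rewrite ge0_fin_numE//; apply: integrable_lty => //.
  exact: (integrableS _ _ (subsetT _) iw).
pose fn := Measure_isFinite.Build _ _ _ _ ffin.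
pose nu : {finite_measure set T -> \bar R} := HB.pack f fm fn.
exists nu; split=> // g M mg gM.
have ig : nu.-integrable setT (EFin \o g).
  apply: measurable_bounded_integrable => //.
    by rewrite -ge0_fin_numE//; exact: fin_num_measure.
  exists `|M|; split => // t Mt x _; apply: (le_trans (gM x)).
  by rewrite (le_trans (ler_norm _))// ltW.
split=> //.
have numu : nu `<< m.
  apply/null_content_dominatesP => A mA A0; apply: null_set_integral => //.
  exact/measurable_funTS/measurable_EFinP.
rewrite -(Radon_Nikodym_change_of_variables numu)//.
apply: ae_eq_integral => //.
- exact: emeasurable_funM (measurable_int _ ig) _.
- by apply/measurable_EFinP; exact: measurable_funM.
- under [X in ae_eq _ _ _ X]eq_fun do rewrite EFinM.
  apply: ae_eqe_mul2l; apply: integral_ae_eq => //.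
  + exact: Radon_Nikodym_integrable.
  + exact/measurable_EFinP.
  + by move=> E _ mE; rewrite -Radon_Nikodym_integral.
Qed.

(** * Null sets under expanding maps *)

(** Two points of [D] sent into ]a, b[ are at distance at most (b - a) / c, so fixing one of them,
    [y], confines the preimage to an interval of that radius about [y]. *)
Lemma expanding_preimage_itv (R : realType) (f : R -> R) (D : set R) (c a b : R) :
  0 < c -> measurable D -> measurable_fun setT f ->
  (forall x y, D x -> D y -> c * `|x - y| <= `|f x - f y|) ->
  (lebesgue_measure (D `&` f @^-1` `]a, b[) <=
   (2 / c)%:E * wlength idfun `]a, b[%classic)%E.
Proof.
move=> c0 mD mf Df.
have [->|/set0P[y [Dy /= fy]]] := eqVneq (D `&` f @^-1` `]a, b[) set0.
  by rewrite measure0 mule_ge0// ?wlength_ge0// lee_fin divr_ge0// ltW.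
move: fy; rewrite in_itv/= => /andP[ay yb].
have ab : a < b by exact: lt_trans yb.
have bac : 0 < (b - a) / c by rewrite divr_gt0// subr_gt0.
apply: (@le_trans _ _ (lebesgue_measure `[y - (b - a) / c, y + (b - a) / c])).
  apply: le_measure; rewrite ?inE//.
    apply: measurableI => //; rewrite -[X in measurable X]setTI.
    exact: mf.
  move=> x [Dx /=]; rewrite !in_itv/= => /andP[ax xb].
  rewrite -ler_distl distrC.
  rewrite ler_pdivlMr// mulrC distrC (le_trans (Df _ _ Dx Dy))//.
  by rewrite ler_distl; apply/andP; split; lra.
rewrite lebesgue_measure_itv/= lte_fin ifT; last lra.
rewrite wlength_itv/= lte_fin ab -!EFinD -EFinM lee_fin.
by rewrite le_eqVlt; apply/orP; left; apply/eqP; field; rewrite gt_eqF.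
Qed.

Lemma expanding_preimage_null (R : realType) (f : R -> R) (D A : set R) (c : R) :
  0 < c -> measurable D -> measurable_fun setT f ->
  (forall x y, D x -> D y -> c * `|x - y| <= `|f x - f y|) ->
  measurable A -> lebesgue_measure A = 0%E ->
  lebesgue_measure (D `&` f @^-1` A) = 0%E.
Proof.
move=> c0 mD mf Df mA A0.
have c2 : 0 < 2 / c by rewrite divr_gt0.
have mpre B : measurable B -> measurable (D `&` f @^-1` B).
  by move=> mB; apply: measurableI => //; rewrite -[X in measurable X]setTI; exact: mf.
apply/eqP; rewrite -measure_le0; apply/lee_addgt0Pr => e e0; rewrite add0e.
(* As an outer measure, the measure 0 of [A] is an infimum of total lengths of open interval covers.
   The tolerance e / (2 / c) absorbs the factor of the preceding bound. *)
have := @outer_measure_open_itv_cover R A.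
rewrite -[LHS]/(lebesgue_measure A) A0 => /esym inf0.
have e' : 0 < e / (2 / c) by rewrite divr_gt0.
have [|_ [F [Fitv AF] <-] Fe] := @lb_ereal_inf_adherent _
  [set (\sum_(k <oo) wlength idfun (F k))%E | F in open_itv_cover A] _ e'.
  by rewrite inf0.
rewrite inf0 add0e in Fe.
have mF k : measurable (F k) by have [ab ->] := Fitv k; exact: measurable_itv.
apply: (@le_trans _ _ (lebesgue_measure (\bigcup_k (D `&` f @^-1` F k)))).
  apply: le_measure; rewrite ?inE.
  - exact: mpre.
  - by apply: bigcupT_measurable => k; exact: mpre.
  - by move=> x [Dx /AF[k _ Fk]]; exists k.
apply: (@le_trans _ _ (\sum_(k <oo) lebesgue_measure (D `&` f @^-1` F k))%E).
  apply: measure_sigma_subadditive => //.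
    by move=> k; exact: mpre.
  by apply: bigcupT_measurable => k; exact: mpre.
apply: (@le_trans _ _ (\sum_(k <oo) (2 / c)%:E * wlength idfun (F k))%E).
  apply: lee_nneseries => // k _; have [ab ->] := Fitv k.
  exact: expanding_preimage_itv.
rewrite nneseriesZl//.
rewrite -lee_pdivlMl// -EFinM mulrC; exact: ltW.
Qed.

(** * Bernoulli inequalities and polynomial steps *)

Lemma bernoulli_ineq (R : realFieldType) (v : R) n : 0 <= v -> 1 + n%:R * v <= (1 + v) ^+ n.
Proof.
move=> v0; elim: n => [|n IHn]; first by rewrite mul0r addr0 expr0.
rewrite exprS -natr1 (le_trans _ (ler_wpM2l _ IHn))//; last by rewrite addr_ge0.
rewrite -subr_ge0.
have -> : (1 + v) * (1 + n%:R * v) - (1 + (n%:R + 1) * v) = n%:R * (v * v) by ring.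
by rewrite mulr_ge0// mulr_ge0.
Qed.

(** By Bernoulli the product is at most ((1 - v)(1 + v))^n, and 1 - v^2 lies in [0, 1]. *)
Lemma expr_onem_le (R : realFieldType) (v : R) n : 0 <= v <= 1 ->
  (1 - v) ^+ n * (1 + n%:R * v) <= 1.
Proof.
move=> /andP[v0 v1].
rewrite (le_trans (ler_wpM2l _ (bernoulli_ineq n v0)))//.
  by rewrite exprn_ge0// subr_ge0.
rewrite -exprMn exprn_ile1//; nra.
Qed.

Lemma expr_onem_ge (R : realFieldType) (v : R) n : 0 <= v <= 1 ->
  1 - n%:R * v <= (1 - v) ^+ n.
Proof.
move=> /andP[v0 v1]; elim: n => [|n IHn]; first by rewrite mul0r subr0 expr0.
rewrite exprS -natr1 (le_trans _ (ler_wpM2l _ IHn))//; last by rewrite subr_ge0.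
rewrite -subr_ge0.
have -> : (1 - v) * (1 - n%:R * v) - (1 - (n%:R + 1) * v) = n%:R * (v * v) by ring.
by rewrite mulr_ge0// mulr_ge0.
Qed.

(* Threshold at u = 1/2: n 4^n u^(2n) = n (2u)^(2n) tends to 0 or to infinity; the
   factor n settles the case u = 1/2. *)
Lemma step_cvg (R : realType) (u : R) : 0 <= u <= 1 ->
  (1 - (u ^+ 2) ^+ n) ^+ (n * 4 ^ n) @[n --> \oo] --> ((u < 2^-1)%R%:R : R).
Proof.
move=> /andP[u0 u1].
have un n : 0 <= (u ^+ 2) ^+ n <= 1 by rewrite !exprn_ge0//= !exprn_ile1// exprn_ge0.
have pow4 n : (4 ^ n)%:R * (u ^+ 2) ^+ n = (2 * u) ^+ n * (2 * u) ^+ n.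
  by rewrite natrX -!exprMn; congr (_ ^+ _); ring.
have [u2|u2] := ltP u 2^-1.
  have r0 : 0 <= 2 * u by rewrite mulr_ge0.
  have r1 : 2 * u < 1 by lra.
  (* This is [expr_onem_le] at v = 1 - 2u. One factor (2u)^n absorbs n, and the other one still
     tends to 0. *)
  have bound n : n%:R * (2 * u) ^+ n <= (1 - 2 * u)^-1.
    rewrite -[leRHS]mul1r ler_pdivlMr ?subr_gt0//.
    have := @expr_onem_le _ (1 - 2 * u) n; rewrite subKr => h.
    apply: (le_trans _ (h _)); last lra.
    by rewrite [leRHS]mulrDr mulr1 [in leRHS]mulrCA mulrA lerDr exprn_ge0.
  apply: (@squeeze_cvgr _ _ _ _ (fun n => 1 - (1 - 2 * u)^-1 * (2 * u) ^+ n) (cst 1)).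
  - near=> n; rewrite exprn_ile1 ?andbT; last 2 first.
      by rewrite subr_ge0; case/andP: (un n).
      by rewrite lerBlDr lerDl; case/andP: (un n).
    apply: (le_trans _ (expr_onem_ge _ (un n))).
    rewrite lerD2l lerN2 natrM -mulrA pow4 mulrA ler_wpM2r//.
    exact: exprn_ge0.
  - rewrite -[X in _ --> X]subr0; apply: cvgB; first exact: cvg_cst.
    rewrite -[X in _ --> X](mulr0 (1 - 2 * u)^-1); apply: cvgM; first exact: cvg_cst.
    by apply: cvg_expr; rewrite ger0_norm.
  - exact: cvg_cst.
(* For 2u >= 1 the exponent times u^(2n) is n (2u)^(2n) >= n, so [expr_onem_le] bounds the power by
   1 / (n + 1). *)
apply: (@squeeze_cvgr _ _ _ _ (cst 0) (@sequences.harmonic R)).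
- near=> n; rewrite exprn_ge0/=; last by rewrite subr_ge0; case/andP: (un n).
  rewrite /sequences.harmonic/= -[leRHS]mul1r ler_pdivlMr//.
  apply: le_trans (expr_onem_le (n * 4 ^ n) (un n)).
  rewrite ler_wpM2l// ?exprn_ge0//; first by rewrite subr_ge0; case/andP: (un n).
  rewrite -natr1 addrC lerD2l natrM -mulrA pow4 ler_peMr// -exprMn exprn_ege1//.
  nra.
- exact: cvg_cst.
- exact: cvg_harmonic.
Unshelve. all: by end_near. Qed.

(** * Measures determined by their moments *)

Section moments.
Context {R : realType}.
Implicit Types mu nu : {measure set (measurableTypeR R) -> \bar R}.

Lemma integrable_poly d (T : measurableType d) (la : {measure set T -> \bar R})
    (f : T -> R) (p : {poly R}) :
  (forall n : nat, la.-integrable setT (fun x => (f x ^+ n)%:E)) ->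
  la.-integrable setT (fun x => p.[f x]%:E).
Proof.
move=> ila; under eq_fun do rewrite horner_coef -sumEFin.
apply: (@integrable_sum _ _ _ la _ measurableT _ _ xpredT
  (fun (i : 'I_(size p)) x => (p`_i * f x ^+ i)%:E)) => // i _.
by under eq_fun do rewrite EFinM; exact: integrableZl.
Qed.

Lemma integral_poly d (T : measurableType d) (la : {measure set T -> \bar R})
    (f : T -> R) (p : {poly R}) :
  (forall n : nat, la.-integrable setT (fun x => (f x ^+ n)%:E)) ->
  (\int[la]_x p.[f x]%:E =
   \sum_(i < size p) (p`_i)%:E * \int[la]_x (f x ^+ i)%:E)%E.
Proof.
move=> ila; under eq_integral do rewrite horner_coef -sumEFin.
rewrite (@integral_sum _ _ _ la _ measurableT _
    (fun (i : 'I_(size p)) x => (p`_i * f x ^+ i)%:E)).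
  by apply: eq_bigr => i _; under eq_integral do rewrite EFinM; rewrite integralZl.
by move=> i; under eq_fun do rewrite EFinM; exact: integrableZl.
Qed.

Lemma measurable_norm_ge (b : R) :
  measurable ([set x | b <= `|x|] : set (measurableTypeR R)).
Proof.
have := @normr_measurable R setT measurableT `[b, +oo[%classic (measurable_itv _).
by rewrite setTI; congr (measurable _); apply/seteqP; split => x /=;
  rewrite in_itv/= andbT.
Qed.

(** Chebyshev's inequality: x^(2n) is at least 4^n M^(2n) on the tail, so 4^n times its mass stays
    below C for every n. *)
Lemma moment_tail mu (M C : R) : 0 < M ->
  (forall n : nat, \int[mu]_x (x ^+ n.*2)%:E <= (C * M ^+ n.*2)%:E)%E ->
  mu [set x | 2 * M <= `|x|] = 0%E.
Proof.
move=> M0 mle.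
set A := [set x | _].
have mA : measurable A by exact: measurable_norm_ge.
have key n : ((4 ^ n)%:R%:E * mu A <= C%:E)%E.
  have Mn : 0 < M ^+ n.*2 by exact: exprn_gt0.
  rewrite -(lee_pmul2r (x := (M ^+ n.*2)%:E))// -EFinM.
  apply: (le_trans _ (mle n)).
  apply: (@le_trans _ _ (\int[mu]_(x in A) (x ^+ n.*2)%:E)%E); last first.
    apply: ge0_subset_integral => //.
      by apply/measurable_EFinP; exact: exprn_measurable.
    by move=> x _; rewrite lee_fin exprn_even_ge0 ?odd_double.
  rewrite muleAC -EFinM -integral_cst//; apply: ge0_le_integral => //.
  - by move=> x _ /=; rewrite lee_fin mulr_ge0// ltW.
  - by apply/measurable_EFinP; exact: exprn_measurable.
  - move=> x Ax /=; rewrite lee_fin -[leRHS](@ger0_norm _ (x ^+ _));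
      last by rewrite exprn_even_ge0 ?odd_double.
    rewrite normrX.
    have -> : (4 ^ n)%:R * M ^+ n.*2 = (2 * M) ^+ n.*2.
      by rewrite exprMn natrX -[X in 2 ^+ X]mul2n exprM; congr (_ ^+ _ * _); ring.
    by rewrite lerXn2r// nnegrE mulr_ge0// ltW.
(* The case n = 0 reads mu A <= C; it yields C >= 0 and a finite tail mass, so that [fine] can be
   used. *)
have C0 : 0 <= C by rewrite -lee_fin (le_trans _ (key 0))// mule_ge0.
have fA : mu A \is a fin_num.
  by rewrite ge0_fin_numE// (le_lt_trans _ (ltry C))// (le_trans _ (key 0))// mul1e.
apply/eqP; rewrite -measure_le0 -[X in (X <= _)%E](fineK fA) lee_fin leNgt.
apply/negP => a0.
set a := fine (mu A) in a0.
have [n Cn] : exists n : nat, C / a < n%:R.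
  by exists (Num.Def.archi_bound (C / a)); apply: archi_boundP; rewrite divr_ge0// ltW.
have := key n; rewrite -[X in (_ * X)%E](fineK fA) -/a -EFinM lee_fin leNgt => /negP; apply.
rewrite -ltr_pdivrMr// (lt_le_trans Cn)// ler_nat.
by rewrite ltnW// ltn_expl.
Qed.

(** Both measures live on ]-2M, 2M[ by [moment_tail]. There the polynomials [p n] stay in [0, 1] and
    tend to the indicator of a ray, so by dominated convergence the moments fix the mass of each
    ray. *)
Lemma moment_unique mu nu (M C : R) : 0 < M ->
  (forall n : nat, mu.-integrable setT (fun x => (x ^+ n)%:E)) ->
  (forall n : nat, nu.-integrable setT (fun x => (x ^+ n)%:E)) ->
  (forall n : nat, \int[mu]_x (x ^+ n)%:E = \int[nu]_x (x ^+ n)%:E)%E ->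
  (forall n : nat, \int[mu]_x (x ^+ n.*2)%:E <= (C * M ^+ n.*2)%:E)%E ->
  forall A, measurable A -> mu A = nu A.
Proof.
move=> M0 imu inu munu mle.
have muA := moment_tail M0 mle.
have nuA : nu [set x | 2 * M <= `|x|] = 0%E.
  by apply: (moment_tail (C := C)) => // n; rewrite -munu.
have mA := @measurable_norm_ge (2 * M).
have mass1 (la : {measure set (measurableTypeR R) -> \bar R}) :
    (forall n : nat, la.-integrable setT (fun x => (x ^+ n)%:E)) ->
    la.-integrable setT (cst 1%E) by move=> /(_ 0).
(* The rays ]-oo, a[ are stable under intersection and generate the Borel sets, and those with
   natural endpoints exhaust the line with finite mass. *)
suff ray a : mu `]-oo, a[%classic = nu `]-oo, a[%classic.
  move=> A mA'; apply: (@measure_unique _ R (measurableTypeR R)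
    (@RGenInftyO.G R) (fun k => `]-oo, k%:R[%classic)) => //.
  - exact: RGenInftyO.measurableE.
  - move=> _ _ [x ->] [y ->]; exists (Order.min x y).
    apply/seteqP; split => z /=; rewrite !in_itv/= lt_min; first by case=> -> ->.
    by move=> /andP[].
  - by move=> k; exists k%:R.
  - apply/seteqP; split => // x _; exists (Num.Def.archi_bound `|x|) => //=.
    by rewrite in_itv/= (le_lt_trans (ler_norm _))// archi_boundP.
  - by move=> _ [x ->]; exact: ray.
  - move=> k; apply: (@le_lt_trans _ _ (mu setT)); first by apply: le_measure; rewrite ?inE.
    have := integrable_lty _ (mass1 _ imu); rewrite integral_cst// mul1e; exact.
(* [L] bounds |x - a| for |x| < 2M, even when [a] lies outside that range. *)
pose L := 2 * M + `|a|.
have L0 : 0 < L by rewrite ltr_wpDr// mulr_gt0.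
(* Affine map of ]-2M, 2M[ into [0, 1] sending a to 1/2. *)
pose u : {poly R} := (2^-1 - a / (2 * L))%:P + (2 * L)^-1 *: 'X.
pose p n := (1 - (u ^+ 2) ^+ n) ^+ (n * 4 ^ n).
have uE x : u.[x] = 2^-1 + (x - a) / (2 * L).
  by rewrite /u !hornerE; field; rewrite gt_eqF.
have pE n x : (p n).[x] = (1 - (u.[x] ^+ 2) ^+ n) ^+ (n * 4 ^ n).
  by rewrite /p !hornerE.
have ux x : `|x| < 2 * M -> 0 <= u.[x] <= 1.
  move=> xM; have : `|x - a| <= L.
    by rewrite (le_trans (ler_normB _ _))// lerD2r ltW.
  rewrite uE ler_norml => /andP[h1 h2].
  have -> : 2^-1 + (x - a) / (2 * L) = (L + (x - a)) / (2 * L) by field; rewrite gt_eqF.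
  by rewrite divr_ge0 ?mulr_ge0 ?(ltW L0)//= ?ler_pdivrMr ?mulr_gt0//; lra.
have cvgp (la : {measure set (measurableTypeR R) -> \bar R}) :
    (forall n : nat, la.-integrable setT (fun x => (x ^+ n)%:E)) ->
    la [set x | 2 * M <= `|x|] = 0%E ->
    (\int[la]_x (p n).[x]%:E)%E @[n --> \oo] --> la `]-oo, a[%classic.
  move=> ila la0.
  have mray : measurable (`]-oo, a[%classic : set R) by exact: measurable_itv.
  have -> : la `]-oo, a[%classic = (\int[la]_x (\1_`]-oo, a[ x)%:E)%E.
    by rewrite integral_indic// setIT.
  have [|||||_ _] // := @dominated_convergence _ _ _ la setT measurableT
     (fun n x => (p n).[x]%:E) (fun x => (\1_`]-oo, a[ x)%:E) (cst 1%E).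
  - by move=> n; exact: measurable_int (integrable_poly _ ila).
  - by apply/measurable_EFinP; exact: measurable_indic.
  (* The null tail is the exceptional set, for this convergence and for the domination by 1
     below. *)
  - exists [set x | 2 * M <= `|x|]; split=> // x /= nH.
    rewrite leNgt; apply/negP => xM; apply: nH => _.
    rewrite indicE mem_setE in_itv/=.
    apply: cvg_EFin; first by near=> n.
    under eq_fun do rewrite /= pE.
    have -> : (x < a) = (u.[x] < 2^-1).
      rewrite uE -subr_lt0 -[RHS]subr_lt0 addrAC subrr add0r.
      by rewrite pmulr_llt0// invr_gt0 mulr_gt0.
    exact/step_cvg/ux.
  - exact: mass1.
  - exists [set x | 2 * M <= `|x|]; split=> // x /= nH.
    rewrite leNgt; apply/negP => xM; apply: nH => n _.
    have /andP[u0 u1] := ux x xM.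
    have v0 : 0 <= (u.[x] ^+ 2) ^+ n <= 1 by rewrite !exprn_ge0//= !exprn_ile1// exprn_ge0.
    rewrite lee_fin pE ger0_norm ?exprn_ge0 ?exprn_ile1//; lra.
have := cvgp _ imu muA.
(* Integrals of [p n] are finite combinations of moments, so those against [mu] and [nu] agree. *)
under eq_fun do rewrite integral_poly//.
under eq_fun do under eq_bigr do rewrite munu.
under eq_fun do rewrite -integral_poly//.
by move=> /cvg_unique; apply => //; exact: cvgp.
Unshelve. all: by end_near. Qed.

End moments.

(** * Images of densities *)

(* The canonical measure structure on [pushforward m f] takes the measurability
   of [f] as an argument, hence this existential form. *)
Lemma pushforward_measure d d' (T1 : measurableType d) (T2 : measurableType d')
    (R : realType) (m : {measure set T1 -> \bar R}) (f : T1 -> T2) :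
  measurable_fun setT f ->
  exists pf : {measure set T2 -> \bar R}, pf = pushforward m f :> (set T2 -> \bar R).
Proof.
by move=> mf; exists (pushforward m f).
Unshelve. exact: mf. Qed.

(** The witness is the image under [f] of the measure with density [w]. Its null sets are expressed
    through preimages, which leaves the metric properties of [f] aside; |f| <= M bounds the even
    moments by the total mass times M^(2n). *)
Lemma pushforward_density (R : realType) (w f : R -> R) (M : R) :
  (forall k, 0 <= w k) ->
  (@lebesgue_measure R).-integrable setT (fun k => (w k)%:E) ->
  measurable_fun setT f -> (forall k, `|f k| <= M) ->
  exists nu : {measure set (measurableTypeR R) -> \bar R},
  [/\ forall A, measurable A ->
        lebesgue_measure (f @^-1` A) = 0%E -> nu A = 0%E,
      forall n : nat, nu.-integrable setT (fun x => (x ^+ n)%:E),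
      forall n : nat, (\int[nu]_x (x ^+ n)%:E =
        \int[@lebesgue_measure R]_k (f k ^+ n * w k)%:E)%E &
      forall n : nat, (\int[nu]_x (x ^+ n.*2)%:E <=
        (fine (\int[@lebesgue_measure R]_k (w k)%:E) * M ^+ n.*2)%:E)%E].
Proof.
move=> w0 iw mf fM.
have [nu [nuE nuf]] := @density_measure _ (measurableTypeR R) R lebesgue_measure w w0 iw.
have fnM n k : `|f k ^+ n| <= M ^+ n.
  by rewrite normrX lerXn2r// nnegrE// (le_trans _ (fM k)).
have mfn n : measurable_fun setT (fun k => f k ^+ n) by exact: measurable_funX.
have [pf pfE] : exists pf : {measure set (measurableTypeR R) -> \bar R},
    pf = pushforward nu (f : measurableTypeR R -> measurableTypeR R) :> (set _ -> _).
  exact: pushforward_measure.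
have mx n : measurable_fun setT (fun x : measurableTypeR R => (x ^+ n)%:E).
  by apply/measurable_EFinP; exact: exprn_measurable.
have pE n : (\int[pf]_x (x ^+ n)%:E =
    \int[@lebesgue_measure R]_k (f k ^+ n * w k)%:E)%E.
  rewrite pfE integral_pushforward//; last exact: (nuf _ _ (mfn n) (fnM n)).1.
  by rewrite preimage_setT -(nuf _ _ (mfn n) (fnM n)).2.
exists pf; split.
- move=> A mA fA; rewrite pfE /pushforward nuE; last first.
    by rewrite -[X in measurable X]setTI; exact: mf.
  apply: null_set_integral => //; first by rewrite -[X in measurable X]setTI; exact: mf.
  exact/measurable_funTS/measurable_int/iw.
- move=> n; rewrite pfE; apply: integrable_pushforward => //.
  exact: (nuf _ _ (mfn n) (fnM n)).1.
- exact: pE.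
- move=> n; rewrite pE mulrC EFinM fineK; last exact: integrable_fin_num.
  have Mn : 0 <= M ^+ n.*2 by exact: (le_trans _ (fnM n.*2 0)).
  have mw : measurable_fun setT w by apply/measurable_EFinP; exact: measurable_int iw.
  rewrite -ge0_integralZl//; last 2 first.
  - exact/measurable_EFinP.
  - by move=> k _; rewrite lee_fin; exact: w0.
  apply: ge0_le_integral => //.
  - by move=> k _; rewrite lee_fin mulr_ge0// exprn_even_ge0 ?odd_double.
  - apply/measurable_EFinP; exact: (measurable_funM (mfn _) mw).
  - by under eq_fun do rewrite -EFinM; apply/measurable_EFinP;
      exact: (measurable_funM (measurable_cst _) mw).
  - by move=> k _; rewrite -EFinM lee_fin ler_wpM2r// (le_trans (ler_norm _)).
Qed.

(** * Symbols and weights of the operator *)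

Section neumann_poincare.
Context {R : realType}.
Implicit Types (k Rad r : R).

(** For x <= y, factor out exp(-yq) >= exp(-Nq) and use exp(t) >= 1 + t at t = (y - x) q. *)
Lemma exp_gap (q x y N : R) : 0 < q -> 0 <= x <= N -> 0 <= y <= N ->
  q * expR (- (N * q)) * `|x - y| <= `|expR (- (x * q)) - expR (- (y * q))|.
Proof.
move=> q0; wlog xy : x y / x <= y => [hw|] xN yN.
  have [|yx] := leP x y; first by move=> ?; exact: hw.
  by rewrite distrC [X in _ <= X]distrC; apply: hw => //; exact: ltW.
have e1 : expR (- (x * q)) = expR (- (y * q)) * expR ((y - x) * q).
  by rewrite -expRD; congr expR; ring.
have h1 := expR_ge1Dx ((y - x) * q).
have h2 : expR (- (N * q)) <= expR (- (y * q)).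
  by rewrite ler_expR lerN2 ler_wpM2r ?(ltW q0)//; case/andP: yN.
rewrite distrC [X in _ <= X]ger0_norm; last first.
  by rewrite subr_ge0 ler_expR lerN2 ler_wpM2r ?(ltW q0).
rewrite ger0_norm ?subr_ge0// e1.
have d0 : 0 <= (y - x) * q by rewrite mulr_ge0 ?subr_ge0// ltW.
have := expR_gt0 (- (y * q)); have := expR_gt0 (- (N * q)); nra.
Qed.

(** The function is even and flattens at infinity, so it is expanding only on bounded pieces of one
    sign, with constant |a| q exp(-nq) on [0, n] and on [-n, 0]. Countably many such pieces cover
    the line. *)
Lemma exp_preimage_null (f : R -> R) (a q : R) (A : set (measurableTypeR R)) :
  a != 0 -> 0 < q -> (forall k, f k = a * expR (- (`|k| * q))) ->
  measurable A -> lebesgue_measure A = 0%E ->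
  lebesgue_measure (f @^-1` A) = 0%E.
Proof.
move=> a0 q0 fE mA A0.
have mf : measurable_fun setT f.
  rewrite (_ : f = fun k => a * expR (- (`|k| * q))); last exact/funext.
  apply: measurable_funM => //; apply: measurableT_comp => //.
  by apply: measurable_funN; apply: measurable_funM => //; exact: normr_measurable.
pose P (n : nat) := `[0, n%:R]%classic `&` f @^-1` A.
pose N (n : nat) := `[- n%:R, 0]%classic `&` f @^-1` A.
have mfA : measurable (f @^-1` A) by rewrite -[X in measurable X]setTI; exact: mf.
have mI (D : set (measurableTypeR R)) : measurable D -> measurable (D `&` f @^-1` A).
  by move=> mD; exact: measurableI.
have c0 (n : nat) : 0 < `|a| * (q * expR (- (n%:R * q))).
  by rewrite !mulr_gt0 ?normr_gt0 ?expR_gt0.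
have P0 n : lebesgue_measure (P n) = 0%E.
  apply: (@expanding_preimage_null R f _ A _ (c0 n)) => // x y /=.
  rewrite !in_itv/= => xn yn; rewrite !fE -mulrBr normrM -mulrA ler_wpM2l//.
  rewrite (ger0_norm (proj1 (andP xn))) (ger0_norm (proj1 (andP yn))).
  exact: exp_gap.
have N0 n : lebesgue_measure (N n) = 0%E.
  apply: (@expanding_preimage_null R f _ A _ (c0 n)) => // x y /=.
  rewrite !in_itv/= => /andP[x1 x2] /andP[y1 y2].
  rewrite !fE -mulrBr normrM -mulrA ler_wpM2l//.
  rewrite (ler0_norm x2) (ler0_norm y2).
  have h := @exp_gap q (- x) (- y) n%:R q0.
  rewrite opprK [- x + y]addrC [`|y - x|]distrC in h.
  by apply: h; rewrite oppr_ge0 lerNl ?x2 ?y2.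
apply: measure_negligible => //.
have /negligibleS : (@lebesgue_measure R).-negligible
    (\bigcup_n (P n `|` N n) : set (measurableTypeR R)); last apply.
  apply: negligible_bigcup => n; apply: negligibleU.
    by exists (P n); split; [apply: mI; exact: measurable_itv|exact: P0|].
  by exists (N n); split; [apply: mI; exact: measurable_itv|exact: N0|].
move=> k fk; exists (Num.Def.archi_bound `|k|) => //.
have kn := ltW (archi_boundP (normr_ge0 k)).
have [k0|k0] := leP 0 k; [left|right]; split => //=; rewrite in_itv/=.
  by rewrite k0/= (le_trans _ kn)// ler_norm.
by rewrite (ltW k0) andbT lerNl (le_trans _ kn)// -normrN ler_norm.
Qed.

Lemma q1_gt0 Rad r : 0 < Rad -> 0 < r -> 0 < q1 Rad r.
Proof. by move=> ? ?; rewrite /q1 addr_gt0 ?invr_gt0 ?mulr_gt0. Qed.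

Lemma expRN_le1 (x : R) : 0 <= x -> expR (- x) <= 1.
Proof. by move=> x0; rewrite -expR0 ler_expR oppr_le0. Qed.

Lemma K1_bound Rad r k : 0 < Rad -> 0 < r -> 0 < K1 Rad r k <= 2^-1.
Proof.
move=> hR hr; rewrite /K1 mulr_gt0 ?expR_gt0 ?invr_gt0//=.
by rewrite ler_piMr ?invr_ge0// expRN_le1// mulr_ge0// ltW// q1_gt0.
Qed.

Lemma S1_ge0 Rad r k : 0 < Rad -> 0 < r -> 0 <= S1 Rad r k.
Proof.
move=> hR hr; rewrite /S1 mulr_ge0 ?invr_ge0 ?mulr_ge0// subr_ge0 expRN_le1//.
by rewrite mulr_ge0// ltW// q1_gt0.
Qed.

Lemma S2_ge0 Rad r k : 0 <= S2 Rad r k.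
Proof.
by rewrite /S2 mulr_ge0 ?invr_ge0 ?mulr_ge0// addr_ge0// expR_ge0.
Qed.

Lemma sqmod_ge0 (z : R[i]) : 0 <= sqmod z.
Proof. by rewrite addr_ge0// sqr_ge0. Qed.

Lemma measurable_inv : measurable_fun setT (@GRing.inv R).
Proof.
(* The real power vanishes at 0, as does the inverse, so the formula holds at x = 0 too. *)
rewrite (_ : @GRing.inv R = fun x => (`|x| `^ (-1)) * (if 0 <= x then 1 else -1)).
  apply: measurable_funM.
    by apply: (measurableT_comp (measurable_powR _)); exact: normr_measurable.
  by apply: measurable_fun_ifT => //; exact: measurable_fun_ler.
apply/funext => x; rewrite powR_inv1//; case: ifPn => [x0|].
  by rewrite ger0_norm// mulr1.
by rewrite -ltNge => x0; rewrite ltr0_norm// invrN mulrN1 opprK.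
Qed.

Lemma measurable_expNq (q : R) : measurable_fun setT (fun k : R => expR (- (`|k| * q))).
Proof.
apply: measurableT_comp => //; apply: measurable_funN.
by apply: measurable_funM => //; exact: normr_measurable.
Qed.

Lemma measurable_K1 Rad r : measurable_fun setT (K1 Rad r).
Proof. by apply: measurable_funM => //; exact: measurable_expNq. Qed.

Lemma measurable_K2 Rad r : measurable_fun setT (K2 Rad r).
Proof. by apply: measurable_funN; exact: measurable_K1. Qed.

Lemma measurable_inv2norm : measurable_fun setT (fun k : R => (2 * `|k|)^-1).
Proof.
apply: measurableT_comp; first exact: measurable_inv.
by apply: measurable_funM => //; exact: normr_measurable.
Qed.

Lemma measurable_S1 Rad r : measurable_fun setT (S1 Rad r).
Proof.
apply: measurable_funM; first exact: measurable_inv2norm.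
by apply: measurable_funB => //; exact: measurable_expNq.
Qed.

Lemma measurable_S2 Rad r : measurable_fun setT (S2 Rad r).
Proof.
apply: measurable_funM; first exact: measurable_inv2norm.
by apply: measurable_funD => //; exact: measurable_expNq.
Qed.

Lemma measurable_sqmod (f : R -> R[i]) : cmeasurable f ->
  measurable_fun setT (fun k => sqmod (f k)).
Proof. by move=> [mr mi]; apply: measurable_funD; exact: measurable_funX. Qed.

(** * Spectral measures *)

Implicit Types phi psi : R -> R[i] * R[i].
Local Notation leb := (@lebesgue_measure R).

Lemma iter_NP Rad r phi n k :
  iter n (NP Rad r) phi k =
  ((real_complex R (K1 Rad r k ^+ n)) * (phi k).1,
   (real_complex R (K2 Rad r k ^+ n)) * (phi k).2).
Proof.
elim: n => [|n IHn]; first by rewrite !expr0 !mul1r -surjective_pairing.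
by rewrite iterS /NP IHn/= !exprS !rmorphM/= !mulrA.
Qed.

Lemma mul_conj_sqmod (z : R[i]) : z * conjc z = real_complex R (sqmod z).
Proof.
case: z => a b; apply/eqP; rewrite eq_complex /sqmod /=.
by apply/andP; split; apply/eqP; ring.
Qed.

Lemma ipf_iter_NP Rad r phi n k :
  ipf Rad r (iter n (NP Rad r) phi) phi k =
  real_complex R (K1 Rad r k ^+ n * (S1 Rad r k * sqmod (phi k).1) +
                  K2 Rad r k ^+ n * (S2 Rad r k * sqmod (phi k).2)).
Proof.
rewrite /ipf iter_NP /= !rmorphD !rmorphM/= -!mul_conj_sqmod.
by congr (_ + _); ring.
Qed.

Lemma integrable_exprM (f w : R -> R) (M : R) n : (forall k, `|f k| <= M) ->
  leb.-integrable setT (fun k => (w k)%:E) -> measurable_fun setT f ->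
  leb.-integrable setT (fun k => (f k ^+ n * w k)%:E).
Proof.
move=> fM iw mf.
have mw : measurable_fun setT w by apply/measurable_EFinP; exact: measurable_int iw.
apply: (le_integrable _ _ _ (integrableZl measurableT (M ^+ n) iw)) => //.
  apply/measurable_EFinP.
  exact: (measurable_funM (measurable_funX n mf) mw).
move=> k _; rewrite -EFinM !abse_EFin lee_fin !normrM ler_wpM2r// normrX.
by rewrite (le_trans _ (ler_norm _))// lerXn2r// nnegrE (le_trans _ (fM k)).
Qed.

(** Nonnegative weights make each summand of [wsq] at most the sum, so each component has its own
    integrable density. *)
Lemma integrable_wsq_parts Rad r phi : 0 < Rad -> 0 < r -> inK Rad r phi ->
  leb.-integrable setT (fun k => (S1 Rad r k * sqmod (phi k).1)%:E) /\
  leb.-integrable setT (fun k => (S2 Rad r k * sqmod (phi k).2)%:E).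
Proof.
move=> hR hr [m1 [m2 fin]].
have w1 k : 0 <= S1 Rad r k * sqmod (phi k).1 by rewrite mulr_ge0 ?S1_ge0 ?sqmod_ge0.
have w2 k : 0 <= S2 Rad r k * sqmod (phi k).2 by rewrite mulr_ge0 ?S2_ge0 ?sqmod_ge0.
have mw1 := measurable_funM (measurable_S1 Rad r) (measurable_sqmod m1).
have mw2 := measurable_funM (measurable_S2 Rad r) (measurable_sqmod m2).
have mw : measurable_fun setT (wsq Rad r phi) by exact: measurable_funD.
have iw : leb.-integrable setT (fun k => (wsq Rad r phi k)%:E).
  apply/integrableP; split; first exact/measurable_EFinP.
  under eq_integral do rewrite gee0_abs ?lee_fin ?addr_ge0//.
  exact: fin.
split.
- apply: (le_integrable _ _ _ iw) => //; first exact/measurable_EFinP.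
  by move=> k _; rewrite !gee0_abs ?lee_fin ?addr_ge0// lerDl.
- apply: (le_integrable _ _ _ iw) => //; first exact/measurable_EFinP.
  by move=> k _; rewrite !gee0_abs ?lee_fin ?addr_ge0// lerDr.
Qed.

(** The measure is the sum of one image measure for each component. The last clause, from |K_i| <=
    1/2, supplies the moment bound that [moment_unique] asks for. *)
Lemma NP_spectral_measure Rad r phi : 0 < Rad -> 0 < r -> inK Rad r phi ->
  exists mu : {measure set (measurableTypeR R) -> \bar R},
  [/\ spectral_measure_of Rad r phi mu,
      forall A, measurable A -> leb A = 0%E -> mu A = 0%E &
      exists C : R, forall n : nat,
        (\int[mu]_x (x ^+ n.*2)%:E <= (C * 2^-1 ^+ n.*2)%:E)%E].
Proof.
move=> hR hr phiK; have [i1 i2] := integrable_wsq_parts hR hr phiK.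
have q0 := q1_gt0 hR hr.
have w1 k : 0 <= S1 Rad r k * sqmod (phi k).1 by rewrite mulr_ge0 ?S1_ge0 ?sqmod_ge0.
have w2 k : 0 <= S2 Rad r k * sqmod (phi k).2 by rewrite mulr_ge0 ?S2_ge0 ?sqmod_ge0.
have K1le k : `|K1 Rad r k| <= 2^-1.
  by have /andP[h1 h2] := K1_bound k hR hr; rewrite ger0_norm// ltW.
have K2le k : `|K2 Rad r k| <= 2^-1 by rewrite normrN; exact: K1le.
have [nu1 [null1 int1 mom1 bnd1]] := pushforward_density w1 i1 (measurable_K1 Rad r) K1le.
have [nu2 [null2 int2 mom2 bnd2]] := pushforward_density w2 i2 (measurable_K2 Rad r) K2le.
have mx n : measurable_fun setT (fun x : measurableTypeR R => (x ^+ n)%:E).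
  by apply/measurable_EFinP; exact: exprn_measurable.
have addE n : (\int[measure_add nu1 nu2]_x (x ^+ n)%:E =
    \int[nu1]_x (x ^+ n)%:E + \int[nu2]_x (x ^+ n)%:E)%E.
  by rewrite integral_measure_add.
exists (measure_add nu1 nu2); split.
- move=> n; split.
    apply/integrableP; split=> //.
    rewrite ge0_integral_measure_add//; last exact: measurableT_comp.
    by case/integrableP: (int1 n) => _ h1; case/integrableP: (int2 n) => _ h2;
       rewrite lte_add_pinfty.
  have ipE := fun k => ipf_iter_NP Rad r phi n k.
  (* The powers of [K1] and [K2] are real, so the integrand is real and the imaginary part of the
     inner product is 0. *)
  rewrite /inner (_ : (fun k => complex.Re (ipf _ _ _ _ k)) = fun k =>
      K1 Rad r k ^+ n * (S1 Rad r k * sqmod (phi k).1) +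
      K2 Rad r k ^+ n * (S2 Rad r k * sqmod (phi k).2)); last first.
    by apply/funext => k; rewrite ipE.
  rewrite (_ : (fun k => complex.Im (ipf _ _ _ _ k)) = cst 0); last first.
    by apply/funext => k; rewrite ipE.
  rewrite [X in Complex _ X]/Rintegral integral0/=; congr Complex.
  rewrite /Rintegral addE mom1 mom2 -integralD//.
  + exact: integrable_exprM K1le i1 (measurable_K1 Rad r).
  + exact: integrable_exprM K2le i2 (measurable_K2 Rad r).
- move=> A mA A0; rewrite [LHS](measure_addE nu1 nu2 A) null1 ?null2 ?adde0//.
  + apply: (@exp_preimage_null _ (- 2^-1) _ _ _ q0) => //.
    by move=> k; rewrite /K2 mulNr.
  + by apply: (@exp_preimage_null _ 2^-1 _ _ _ q0).
- exists (fine (\int[leb]_k (S1 Rad r k * sqmod (phi k).1)%:E) +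
          fine (\int[leb]_k (S2 Rad r k * sqmod (phi k).2)%:E)) => n.
  by rewrite addE mulrDl EFinD leeD.
Qed.

(** [only_ac_spectrum] speaks of every measure with the right moments; [moment_unique] identifies
    each of them with the one constructed above. *)
Lemma NP_only_ac Rad r : 0 < Rad -> 0 < r -> only_ac_spectrum Rad r.
Proof.
move=> hR hr phi phiK.
have [mu [smu mu0 [C muC]]] := NP_spectral_measure hR hr phiK.
split; first by exists mu.
move=> nu snu; apply/null_content_dominatesP => A mA A0.
have <- : mu A = nu A; last exact: mu0.
apply: (@moment_unique _ mu nu 2^-1 C) => // [n|n|n].
- exact: (smu n).1.
- exact: (snu n).1.
- rewrite -[LHS]fineK; last exact: integrable_fin_num (smu n).1.
  rewrite -[RHS]fineK; last exact: integrable_fin_num (snu n).1.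
  congr EFin; apply: complexI; exact: (etrans (smu n).2 (esym (snu n).2)).
Qed.

(** * Resolvent set *)

Lemma ae_lebesgueS (P Q : R -> Prop) : (forall k, P k -> Q k) ->
  {ae leb, forall k, P k} -> {ae leb, forall k, Q k}.
Proof. exact: (@filterS _ _ (ae_filter_ringOfSetsType leb)). Qed.

Lemma wsq_ge0 Rad r phi k : 0 < Rad -> 0 < r -> 0 <= wsq Rad r phi k.
Proof. by move=> hR hr; rewrite addr_ge0// mulr_ge0 ?S1_ge0 ?S2_ge0 ?sqmod_ge0. Qed.

Lemma measurable_wsq Rad r phi : inK Rad r phi -> measurable_fun setT (wsq Rad r phi).
Proof.
move=> [m1 [m2 _]]; apply: measurable_funD; apply: measurable_funM.
- exact: measurable_S1.
- exact: measurable_sqmod.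
- exact: measurable_S2.
- exact: measurable_sqmod.
Qed.

Lemma normsqE Rad r phi : 0 < Rad -> 0 < r -> inK Rad r phi ->
  (normsq Rad r phi)%:E = (\int[leb]_k (wsq Rad r phi k)%:E)%E.
Proof.
move=> hR hr phiK; rewrite /normsq /Rintegral fineK// ge0_fin_numE.
  by case: phiK => _ [].
by apply: integral_ge0 => k _; rewrite lee_fin wsq_ge0.
Qed.

Lemma normsq_le_ae Rad r phi psi (c : R) : 0 < Rad -> 0 < r -> 0 <= c ->
  inK Rad r phi -> inK Rad r psi ->
  {ae leb, forall k, wsq Rad r phi k <= c * wsq Rad r psi k} ->
  normsq Rad r phi <= c * normsq Rad r psi.
Proof.
move=> hR hr c0 phiK psiK le.
have mphi := measurable_wsq phiK; have mpsi := measurable_wsq psiK.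
rewrite -lee_fin EFinM !normsqE// -ge0_integralZl//; last 2 first.
- exact/measurable_EFinP.
- by move=> k _; rewrite lee_fin wsq_ge0.
apply: ae_ge0_le_integral => //.
- by move=> k _; rewrite lee_fin wsq_ge0.
- exact/measurable_EFinP.
- by move=> k _; rewrite mule_ge0// lee_fin wsq_ge0.
- under eq_fun do rewrite -EFinM.
  apply/measurable_EFinP; exact: (measurable_funM (measurable_cst c) mpsi).
- by apply: ae_lebesgueS le => k hk _; rewrite -EFinM lee_fin.
Qed.

(** The quotient w / (c + i d) in real coordinates, where measurability can be checked part by part.
    It is used with c + i d = t - z. *)
Definition cdiv (w : R[i]) (c d : R) : R[i] :=
  Complex ((complex.Re w * c + complex.Im w * d) / (c ^+ 2 + d ^+ 2))
          ((complex.Im w * c - complex.Re w * d) / (c ^+ 2 + d ^+ 2)).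

Lemma cdivK (w : R[i]) (t : R) (z : R[i]) :
  (t - complex.Re z) ^+ 2 + complex.Im z ^+ 2 != 0 ->
  real_complex R t * cdiv w (t - complex.Re z) (- complex.Im z) -
    z * cdiv w (t - complex.Re z) (- complex.Im z) = w.
Proof.
case: w z => a b [x y] /= h; apply/eqP; rewrite eq_complex /=.
by apply/andP; split; apply/eqP; field; rewrite sqrrN.
Qed.

Lemma sqmod_cdiv (w : R[i]) (c d : R) : c ^+ 2 + d ^+ 2 != 0 ->
  sqmod (cdiv w c d) = sqmod w / (c ^+ 2 + d ^+ 2).
Proof. by move=> h; rewrite /sqmod /=; field. Qed.

Lemma measurable_cdiv (f : R -> R[i]) (g : R -> R) (d : R) :
  cmeasurable f -> measurable_fun setT g ->
  cmeasurable (fun k => cdiv (f k) (g k) d).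
Proof.
move=> [mr mi] mg.
have mden : measurable_fun setT (fun k => (g k ^+ 2 + d ^+ 2)^-1).
  apply: (measurableT_comp measurable_inv).
  by apply: measurable_funD => //; exact: measurable_funX.
split; apply: measurable_funM => //.
- by apply: measurable_funD; exact: measurable_funM.
- by apply: measurable_funB; exact: measurable_funM.
Qed.

Lemma sqmodM (z w : R[i]) : sqmod (z * w) = sqmod z * sqmod w.
Proof. by case: z w => a b [c d]; rewrite /sqmod /=; ring. Qed.

Lemma sqmod_eq0 (z : R[i]) : sqmod z = 0 -> z = 0.
Proof.
case: z => a b /eqP; rewrite /sqmod paddr_eq0 ?sqr_ge0//= !sqrf_eq0.
by move=> /andP[/eqP-> /eqP->].
Qed.

Lemma sqmod_subr (t : R) (z : R[i]) :
  sqmod (real_complex R t - z) = (t - complex.Re z) ^+ 2 + complex.Im z ^+ 2.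
Proof. by case: z => x y; rewrite /sqmod /=; ring. Qed.

(** Since |t - z|^2 >= d on the range of both symbols, dividing each component by K_i - z inverts
    the operator pointwise. *)
Lemma resolvent_gap Rad r (z : R[i]) (d : R) : 0 < Rad -> 0 < r -> 0 < d ->
  (forall t : R, - 2^-1 <= t <= 2^-1 ->
     d <= (t - complex.Re z) ^+ 2 + complex.Im z ^+ 2) ->
  resolvent Rad r z.
Proof.
move=> hR hr d0 hd.
have h1 k : d <= (K1 Rad r k - complex.Re z) ^+ 2 + complex.Im z ^+ 2.
  by apply: hd; have := K1_bound k hR hr; lra.
have h2 k : d <= (K2 Rad r k - complex.Re z) ^+ 2 + complex.Im z ^+ 2.
  by apply: hd; have := K1_bound k hR hr; rewrite /K2 -/(K1 Rad r k); lra.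
have n1 k : (K1 Rad r k - complex.Re z) ^+ 2 + complex.Im z ^+ 2 != 0.
  by rewrite gt_eqF// (lt_le_trans d0).
have n2 k : (K2 Rad r k - complex.Re z) ^+ 2 + complex.Im z ^+ 2 != 0.
  by rewrite gt_eqF// (lt_le_trans d0).
have inj (t : R) (w : R[i]) : (t - complex.Re z) ^+ 2 + complex.Im z ^+ 2 != 0 ->
    real_complex R t * w - z * w = 0 -> w = 0.
  move=> tz; rewrite -mulrBl => /(congr1 (@sqmod R)).
  rewrite sqmodM sqmod_subr {2}/sqmod/= expr0n/= addr0 => /eqP.
  by rewrite mulf_eq0 (negPf tz)/= => /eqP /sqmod_eq0.
split.
  move=> phi _; apply: ae_lebesgueS => k [e1 e2].
  by rewrite (surjective_pairing (phi k)) (inj _ _ (n1 k) e1) (inj _ _ (n2 k) e2).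
(* [d] bounds a squared distance and [normsq] is a squared norm, hence 1 / d without a root. *)
exists d^-1 => psi psiK.
pose phi k := (cdiv (psi k).1 (K1 Rad r k - complex.Re z) (- complex.Im z),
               cdiv (psi k).2 (K2 Rad r k - complex.Re z) (- complex.Im z)).
have wle k : wsq Rad r phi k <= d^-1 * wsq Rad r psi k.
  rewrite /wsq /phi /= !sqmod_cdiv ?sqrrN// mulrDr [d^-1 * (S1 _ _ _ * _)]mulrCA
    [d^-1 * (S2 _ _ _ * _)]mulrCA.
  apply: lerD; apply: ler_wpM2l; rewrite ?S1_ge0 ?S2_ge0// mulrC ler_wpM2r ?sqmod_ge0//;
  by rewrite lef_pV2// posrE (lt_le_trans d0).
have phiK : inK Rad r phi.
  have [m1 [m2 fin]] := psiK.
  have mp1 : cmeasurable (fun k => (phi k).1).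
    by apply: measurable_cdiv => //; apply: measurable_funB => //; exact: measurable_K1.
  have mp2 : cmeasurable (fun k => (phi k).2).
    by apply: measurable_cdiv => //; apply: measurable_funB => //; exact: measurable_K2.
  have mw : measurable_fun setT (wsq Rad r phi).
    apply: measurable_funD; apply: measurable_funM.
    - exact: measurable_S1.
    - exact: measurable_sqmod.
    - exact: measurable_S2.
    - exact: measurable_sqmod.
  have mpsi := measurable_wsq psiK.
  split=> //; split=> //.
  apply: (@le_lt_trans _ _ (\int[leb]_k (d^-1%:E * (wsq Rad r psi k)%:E))%E).
    apply: ge0_le_integral => //.
    - by move=> k _; rewrite lee_fin wsq_ge0.
    - exact/measurable_EFinP.
    - under eq_fun do rewrite -EFinM.
      apply/measurable_EFinP; exact: (measurable_funM (measurable_cst _) mpsi).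
    - by move=> k _; rewrite -EFinM lee_fin.
  rewrite ge0_integralZl//; last 3 first.
  - exact/measurable_EFinP.
  - by move=> k _; rewrite lee_fin wsq_ge0.
  - by rewrite lee_fin invr_ge0 ltW.
  by rewrite -normsqE// -EFinM ltry.
exists phi; split=> //.
- apply/aeW => k; rewrite /NPshift /NP /= !cdivK//.
  exact/esym/surjective_pairing.
- apply: normsq_le_ae => //; first by rewrite invr_ge0 ltW.
  exact/aeW.
Qed.

(** * Points of the segment *)

(** A solution [phi] for the right-hand side [psi] would satisfy normsq psi <= e normsq phi <= e c
    normsq psi, which is absurd once e c < 1. *)
Lemma not_resolvent_approx Rad r (z : R[i]) : 0 < Rad -> 0 < r ->
  (forall e : R, 0 < e -> exists psi, [/\ inK Rad r psi, 0 < normsq Rad r psi &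
     forall phi k, NPshift Rad r z phi k = psi k ->
       wsq Rad r psi k <= e * wsq Rad r phi k]) ->
  ~ resolvent Rad r z.
Proof.
move=> hR hr approx [_ [c hc]].
(* The choice e = 1 / (|c| + 1) gives e c < 1 whatever the sign of [c]. *)
have c0 : 0 < (`|c| + 1)^-1 by rewrite invr_gt0 ltr_pwDr.
have [psi [psiK psi0 hpsi]] := approx _ c0.
have [phi [phiK phipsi phic]] := hc _ psiK.
have : normsq Rad r psi <= (`|c| + 1)^-1 * normsq Rad r phi.
  apply: normsq_le_ae => //.
  by apply: ae_lebesgueS phipsi => k; exact: hpsi.
apply/negP; rewrite -ltNge mulrC ltr_pdivrMr; last by rewrite ltr_pwDr.
rewrite (le_lt_trans phic)// mulrC ltr_pM2l//.
by rewrite (le_lt_trans (ler_norm _))// ltrDl.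
Qed.

(* The point x is first moved towards 1/4, into the open range ]0, 1/2[ of K1 on
   the positive half-line. *)
Lemma K1_near Rad r (x e : R) : 0 < Rad -> 0 < r -> 0 <= x <= 2^-1 -> 0 < e ->
  exists a b : R, [/\ 0 < a, a < b &
    forall k, a <= k <= b -> (K1 Rad r k - x) ^+ 2 <= e].
Proof.
move=> hR hr /andP[x0 x1] e0; have q0 := q1_gt0 hR hr.
set q := q1 Rad r in q0.
(* d <= 1 makes [y] a convex combination of x and 1/4, within d / 4 of x; the final bound is d^2 <=
   d <= e. *)
pose d := Num.min 1 e; have d0 : 0 < d by rewrite lt_min ltr01.
have d1 : d <= 1 by rewrite ge_min lexx.
have de : d <= e by rewrite ge_min lexx orbT.
pose y := x + d * (4^-1 - x).
have y0 : 0 < y by rewrite /y; nra.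
have y1 : 2 * y < 1 by rewrite /y; nra.
(* The positive point where [K1] takes the value [y]. *)
pose a := - ln (2 * y) / q.
have a0 : 0 < a by rewrite divr_gt0// oppr_gt0 ln_lt0// mulr_gt0.
have aq : a * q = - ln (2 * y) by rewrite /a divfK// gt_eqF.
have Ka k : a <= k -> K1 Rad r k = y * expR (- ((k - a) * q)).
  move=> ak; rewrite /K1 -/q ger0_norm ?(le_trans (ltW a0))//.
  have -> : - (k * q) = - (a * q) + - ((k - a) * q) by ring.
  by rewrite expRD aq opprK lnK ?posrE ?mulr_gt0//; field.
(* On this interval the exponential factor lies in [1 - d, 1] and y < 1/2, so [K1] stays within d /
   2 of [y]. *)
exists a, (a + d / q); split => //; first by rewrite ltrDl divr_gt0.
move=> k /andP[ak kb].
have kq0 : 0 <= (k - a) * q by rewrite mulr_ge0 ?subr_ge0// ltW.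
have kqd : (k - a) * q <= d by rewrite -ler_pdivlMr// lerBlDl.
have E1 := expR_ge1Dx (- ((k - a) * q)); have E2 := expRN_le1 kq0.
rewrite Ka//; set E := expR _ in E1 E2 *.
have h : - d <= y * E - x <= d.
  by rewrite /y in y0 y1 *; apply/andP; split; nra.
have : (y * E - x) ^+ 2 <= d * d by nra.
nra.
Qed.

Lemma measurable_sqrt : measurable_fun setT (@Num.sqrt R).
Proof. by apply: continuous_measurable_fun; exact: sqrt_continuous. Qed.

Lemma cmeasurable_bump (S : R -> R) (E : set R) : measurable E ->
  measurable_fun setT S ->
  cmeasurable (fun k => real_complex R (Num.sqrt (S k)^-1 * \1_E k)).
Proof.
move=> mE mS; split => /=; last exact: measurable_cst.
apply: measurable_funM; last exact: measurable_indic.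
apply: (measurableT_comp measurable_sqrt); exact: (measurableT_comp measurable_inv).
Qed.

(* The amplitude S^(-1/2) turns the weighted square modulus into an indicator. *)
Lemma bump_weight (S : R -> R) (E : set R) k : (E k -> 0 < S k) ->
  S k * sqmod (real_complex R (Num.sqrt (S k)^-1 * \1_E k)) = \1_E k.
Proof.
move=> S0; rewrite /sqmod /= expr0n/= addr0 exprMn indicE.
have [kE|] := boolP (k \in E); last by rewrite expr0n/= !mulr0.
have Sk : 0 < S k by apply: S0; rewrite inE in kE.
by rewrite sqr_sqrtr ?invr_ge0 ?(ltW Sk)// expr1n mulr1 divff// gt_eqF.
Qed.

(** The squared norm is the length b - a, hence finite and positive. *)
Lemma inK_indic Rad r psi (a b : R) : 0 < Rad -> 0 < r -> a < b ->
  cmeasurable (fun k => (psi k).1) -> cmeasurable (fun k => (psi k).2) ->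
  (forall k, wsq Rad r psi k = \1_`[a, b] k) ->
  inK Rad r psi /\ 0 < normsq Rad r psi.
Proof.
move=> hR hr ab m1 m2 psiE.
have I : (\int[leb]_k (wsq Rad r psi k)%:E = (b - a)%:E)%E.
  under eq_integral do rewrite psiE.
  by rewrite integral_indic//= setIT lebesgue_measure_itv/= lte_fin ab EFinB.
have psiK : inK Rad r psi by do 2!split=> //; rewrite I ltry.
by split=> //; rewrite -lte_fin normsqE// I lte_fin subr_gt0.
Qed.

Lemma S1_gt0 Rad r k : 0 < Rad -> 0 < r -> 0 < k -> 0 < S1 Rad r k.
Proof.
move=> hR hr k0; rewrite /S1 gtr0_norm// mulr_gt0 ?invr_gt0 ?mulr_gt0//.
by rewrite subr_gt0 -expR0 ltr_expR oppr_lt0 mulr_gt0// q1_gt0.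
Qed.

Lemma S2_gt0 Rad r k : 0 < k -> 0 < S2 Rad r k.
Proof.
move=> k0; rewrite /S2 gtr0_norm// mulr_gt0 ?invr_gt0 ?mulr_gt0//.
Qed.

(** [K1] takes values in ]0, 1/2] and [K2] in [-1/2, 0[, so the bump sits in the first component for
    Re z >= 0 and in the second otherwise, on an interval where |K_i - z|^2 <= e. *)
Lemma segment_not_resolvent Rad r (z : R[i]) : 0 < Rad -> 0 < r -> complex.Im z = 0 ->
  - 2^-1 <= complex.Re z <= 2^-1 -> ~ resolvent Rad r z.
Proof.
move=> hR hr z0 /andP[z1 z2]; apply: not_resolvent_approx => // e e0.
have sub (t : R) (w v : R[i]) : (t - complex.Re z) ^+ 2 <= e ->
    real_complex R t * w - z * w = v -> sqmod v <= e * sqmod w.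
  move=> te <-; rewrite -mulrBl sqmodM sqmod_subr z0 expr0n/= addr0.
  by rewrite ler_wpM2r// sqmod_ge0.
have [x0|x0] := leP 0 (complex.Re z).
- have [|a [b [a0 ab Kab]]] := K1_near (x := complex.Re z) hR hr _ e0.
    by rewrite x0.
  have S0 k : `[a, b]%classic k -> 0 < S1 Rad r k.
    by rewrite /= in_itv/= => /andP[ak _]; rewrite S1_gt0// (lt_le_trans a0).
  pose psi k := (real_complex R (Num.sqrt (S1 Rad r k)^-1 * \1_`[a, b] k), 0 : R[i]).
  have psiE k : wsq Rad r psi k = \1_`[a, b] k.
    by rewrite /wsq /psi /= (bump_weight (S0 k)) /sqmod/= expr0n/= addr0 mulr0 addr0.
  have [||psiK psi0] := inK_indic hR hr ab _ _ psiE.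
  + by apply: cmeasurable_bump; [exact: measurable_itv|exact: measurable_S1].
  + by split; exact: measurable_cst.
  exists psi; split=> // phi k [e1 _].
  (* Off the interval [psi] has zero weight and the bound is trivial. *)
  have [kE|kE] := boolP (k \in `[a, b]%classic); last first.
    by rewrite psiE indicE (negPf kE) mulr_ge0 ?wsq_ge0// ltW.
  have ke : (K1 Rad r k - complex.Re z) ^+ 2 <= e.
    by apply: Kab; move: kE; rewrite inE/= in_itv.
  rewrite {1}/wsq /= {2}/sqmod/= expr0n/= addr0 mulr0 addr0.
  rewrite (le_trans (ler_wpM2l (S1_ge0 k hR hr) (sub _ _ _ ke e1)))//.
  by rewrite mulrCA ler_wpM2l ?(ltW e0)// lerDl mulr_ge0 ?S2_ge0 ?sqmod_ge0.
(* As [K2] is the opposite of [K1], it comes close to Re z where [K1] is close to -Re z. *)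
- have [|a [b [a0 ab Kab]]] := K1_near (x := - complex.Re z) hR hr _ e0.
    by rewrite oppr_ge0 (ltW x0)/= lerNl.
  have S0 k : `[a, b]%classic k -> 0 < S2 Rad r k.
    by rewrite /= in_itv/= => /andP[ak _]; rewrite S2_gt0// (lt_le_trans a0).
  pose psi k := (0 : R[i], real_complex R (Num.sqrt (S2 Rad r k)^-1 * \1_`[a, b] k)).
  have psiE k : wsq Rad r psi k = \1_`[a, b] k.
    by rewrite /wsq /psi /= (bump_weight (S0 k)) /sqmod/= expr0n/= addr0 mulr0 add0r.
  have [||psiK psi0] := inK_indic hR hr ab _ _ psiE.
  + by split; exact: measurable_cst.
  + by apply: cmeasurable_bump; [exact: measurable_itv|exact: measurable_S2].
  exists psi; split=> // phi k [_ e2].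
  have [kE|kE] := boolP (k \in `[a, b]%classic); last first.
    by rewrite psiE indicE (negPf kE) mulr_ge0 ?wsq_ge0// ltW.
  have ke : (K2 Rad r k - complex.Re z) ^+ 2 <= e.
    rewrite (_ : K2 Rad r k - _ = - (K1 Rad r k - - complex.Re z)); last first.
      by rewrite /K2 -/(K1 Rad r k); ring.
    by rewrite sqrrN; apply: Kab; move: kE; rewrite inE/= in_itv.
  rewrite {1}/wsq /= {1}/sqmod/= expr0n/= addr0 mulr0 add0r.
  rewrite (le_trans (ler_wpM2l (S2_ge0 Rad r k) (sub _ _ _ ke e2)))//.
  by rewrite mulrCA ler_wpM2l ?(ltW e0)// lerDr mulr_ge0 ?S1_ge0 ?sqmod_ge0.
Qed.

(** The gap is (Im z)^2 for nonreal z, and for real z the squared distance to the nearer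
    endpoint. *)
Lemma segment_gap (z : R[i]) :
  ~ (complex.Im z = 0 /\ - 2^-1 <= complex.Re z <= 2^-1) ->
  exists2 d : R, 0 < d & forall t : R, - 2^-1 <= t <= 2^-1 ->
     d <= (t - complex.Re z) ^+ 2 + complex.Im z ^+ 2.
Proof.
move=> zS; have [z0|z0] := eqVneq (complex.Im z) 0; last first.
  exists (complex.Im z ^+ 2); first by rewrite exprn_even_gt0.
  by move=> t _; rewrite lerDr sqr_ge0.
have /orP[zl|zr] : (complex.Re z < - 2^-1) || (2^-1 < complex.Re z).
- by rewrite -[_ || _]negbK negb_or -!leNgt; apply/negP => h; apply: zS.
- exists ((2^-1 + complex.Re z) ^+ 2); first by rewrite exprn_even_gt0//=; lra.
  by move=> t /andP[t1 t2]; rewrite z0; nra.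
- exists ((2^-1 - complex.Re z) ^+ 2); first by rewrite exprn_even_gt0//=; lra.
  by move=> t /andP[t1 t2]; rewrite z0; nra.
Qed.

End neumann_poincare.

Theorem theorem4p6 (R : realType) (Rad r : R) (hRad : 0 < Rad) (hr : 0 < r) :
  only_ac_spectrum Rad r /\
  spectrum Rad r = [set z : R[i] | complex.Im z = 0 /\
                                   - 2^-1 <= complex.Re z <= 2^-1].
Proof.
split; first exact: NP_only_ac.
apply/seteqP; split => z /=; last by move=> [z0 z1]; exact: segment_not_resolvent.
apply: contra_notP => /segment_gap[d d0 hd].
exact: resolvent_gap hd.
Qed.
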